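(* Let $\varepsilon\in\mathbb{R}$ satisfy $-\tfrac{1}{15}<\varepsilon<0$. Then the planar piecewise smooth system $$\dot x = 1-x-k(y)\,x,\qquad \dot y=\beta-\beta\varepsilon-k(y)\,\varepsilon-\alpha-(\beta+k(y))\,y-(\alpha\beta-\alpha)\,x,$$ with $\alpha=\tfrac45$, $\beta=\tfrac12$, $k(y)=1$ for $y>0$ and $k(y)=0$ for $y<0$, with dynamics on $\{y=0\}$ given by Filippov's convention, has a periodic orbit which intersects the line $y=0$ at a point whose $x$-coordinate lies in the interval $$I=\left(\tfrac12,\ \tfrac34+\tfrac{15}{4}\varepsilon\right).$$
   Context: For $\lambda\in[0,1]$ write $f(x,y;\lambda)=\bigl(1-x-\lambda x,\ \beta-\beta\varepsilon-\lambda\varepsilon-\alpha-(\beta+\lambda)y-(\alpha\beta-\alpha)x\bigr)$ with $\alpha=4/5$, $\beta=1/2$; equivalently $f(x,y;\lambda)=\bigl(1-(1+\lambda)x,\ -\tfrac{3}{10}+\tfrac25 x-(\tfrac12+\lambda)(y+\varepsilon)\bigr)$. The system is $(\dot x,\dot y)=f(x,y;k(y))$ for $y\neq 0$. A Filippov solution is an absolutely continuous curve $\gamma(t)=(x(t),y(t))$ with $\dot\gamma(t)\in F(\gamma(t))$ for almost every $t$, where $F(x,y)=\{f(x,y;k(y))\}$ if $y\ne0$ and $F(x,0)=\{f(x,0;\lambda):\lambda\in[0,1]\}$. In particular, at points of $\{y=0\}$ where the second components of $f(x,0;0)$ and $f(x,0;1)$ have the same strict sign, trajectories cross the line $y=0$.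 A periodic orbit is the image of a nonconstant periodic Filippov solution. *)

(* Defs.v *)
(* MathComp / MathComp-Analysis, over an arbitrary realType R. *)
From mathcomp Require Import all_boot all_order all_algebra.
From mathcomp Require Import all_classical all_reals all_analysis.

Set Implicit Arguments.
Unset Strict Implicit.
Unset Printing Implicit Defensive.

Import Order.TTheory GRing.Theory Num.Theory.
Import numFieldNormedType.Exports.
Local Open Scope classical_set_scope.
Local Open Scope ring_scope.

Definition alpha {R : realType} : R := 4 / 5.
Definition beta {R : realType} : R := 1 / 2.

(* The value at y = 0 is irrelevant: filippov uses k only for y != 0. *)
Definition k {R : realType} (y : R) : R := if 0 < y then 1 else 0.

Definition field {R : realType} (eps : R) (p : R * R) (lambda : R) : R * R :=
  let x := p.1 in let y := p.2 in
  (1 - x - lambda * x,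
   beta - beta * eps - lambda * eps - alpha - (beta + lambda) * y
     - (alpha * beta - alpha) * x).

Definition filippov {R : realType} (eps : R) (p : R * R) : set (R * R) :=
  if p.2 == 0 then [set field eps p lambda | lambda in `[0, 1]%classic]
  else [set field eps p (k p.2)].

Definition abs_continuous {R : realType} {V : normedModType R}
    (a b : R) (g : R -> V) : Prop :=
  forall e : R, 0 < e -> exists2 d : R, 0 < d &
    forall (n : nat) (u v : 'I_n -> R),
      (forall i, a <= u i /\ u i <= v i /\ v i <= b) ->
      trivIset setT (fun i => `]u i, v i[%classic) ->
      \sum_(i < n) (v i - u i) < d ->
      \sum_(i < n) `|g (v i) - g (u i)| < e.

(* For curves defined on the whole line, absolute continuity means absolute
   continuity on every compact interval. *)
Definition filippov_solution {R : realType} (eps : R) (gamma : R -> R * R) :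
    Prop :=
  (forall a b : R, a <= b -> abs_continuous a b gamma) /\
  {ae (@lebesgue_measure R), forall t : R,
     exists2 w : R * R, filippov eps (gamma t) w &
       is_derive t (1 : R) gamma w}.

Definition periodic_orbit {R : realType} (eps : R) (Gamma : set (R * R)) :
    Prop :=
  exists gamma : R -> R * R,
    [/\ filippov_solution eps gamma,
        exists2 T : R, 0 < T & forall t, gamma (t + T) = gamma t,
        exists s t : R, gamma s <> gamma t
      & Gamma = range gamma].

(* Main.v *)
Require Import Defs.
From mathcomp Require Import all_boot all_order all_algebra.
From mathcomp Require Import all_classical all_reals all_analysis.
From mathcomp Require Import ring lra.

(** The two affine systems glued along y = 0 have triangular matrices, so their
trajectories are explicit: in the half-plane y < 0 (lambda = 0) the rates are 1
and 1/2, in y > 0 (lambda = 1) they are 2 and 3/2. All rates are multiples of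
1/2, hence with s = exp (- t / 2) a trajectory leaving (x0, 0) is a polynomial
curve in s, and the factor 1 - s of its second component, which vanishes at the
starting time, splits off:
  below, y = (1 - s) (1/5 - eps - 4/5 (1 - x0) s);
  above, y = (1 - s) (4/5 (x1 - 1/2) s^3 - (1/15 + eps) (1 + s + s^2)).
Each equilibrium lies on the wrong side of the line (heights 1/5 - eps > 0 for
the lower system, - 1/15 - eps < 0 for the upper one), so a trajectory that
enters a half-plane comes back to y = 0, namely at the zero of the second
factor.

A periodic orbit that goes down at x0 and up at x1 is thus a solution of two
algebraic equations. Let w be the value of s at the end of the upper arc and
a = 1/15 + eps. The upper arc gives both crossings as functions of w,
  x0 = 1/2 + 5/4 a (w + w^2 + w^3),  x1 = 1/2 + 5/4 a (1/w + 1/w^2 + 1/w^3),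
and the lower arc closes up exactly when
  (1 - x0) (1 - x1) = (1/3 - 5/4 a)^2.
The left side exceeds the right side at w = 1 and does not at w = 5a/2, so the
intermediate value theorem for polynomials yields w in ]0, 1[
([closing_equation]); then 0 < w < 1 places x0 in ]1/2, 3/4 + 15/4 eps[, and
the second factors above have the signs needed for each arc to stay on its side
of the line ([closed_crossings]).

It remains to see that running the two arcs alternately forever is a Filippov
solution ([loop_periodic_orbit]). The resulting curve is Lipschitz, hence
absolutely continuous, and it solves the differential equation classically
except at the crossing times, which form a countable and so negligible set. *)

Set Implicit Arguments.
Unset Strict Implicit.
Unset Printing Implicit Defensive.

Import Order.TTheory GRing.Theory Num.Theory.
Import numFieldNormedType.Exports.
Local Open Scope classical_set_scope.
Local Open Scope ring_scope.

(** * Lipschitz curves and periodic extension *)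

(** The endpoints are ordered so that the inequality can be chained along an
interval, which is how arcs are glued below. *)
Definition lipschitz_between {R : realType} {V : normedModType R}
    (L a b : R) (g : R -> V) : Prop :=
  forall u v, a <= u -> u <= v -> v <= b -> `|g v - g u| <= L * (v - u).

Lemma lipschitz_between_abs_continuous (R : realType) (V : normedModType R)
    (L a b : R) (g : R -> V) :
  0 <= L -> lipschitz_between L a b g -> abs_continuous a b g.
Proof.
move=> L0 gL e e0; have L1 : 0 < L + 1 by lra.
exists (e / (L + 1)); first exact: divr_gt0.
move=> n u v uv _; rewrite ltr_pdivlMr // => sum_lt.
apply: le_lt_trans sum_lt; rewrite mulr_suml; apply: ler_sum => i _.
have [au [uvi vb]] := uv i.
apply: le_trans (gL _ _ au uvi vb) _; nra.
Qed.

Lemma lipschitz_between_glue (R : realType) (V : normedModType R)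
    (L a b c : R) (g : R -> V) :
  lipschitz_between L a b g -> lipschitz_between L b c g ->
  lipschitz_between L a c g.
Proof.
move=> gab gbc u v au uv vc.
have [vb|bv] := leP v b; first exact: gab.
have [bu|ub] := leP b u; first exact: gbc.
apply: le_trans (ler_distD (g b) _ _) _.
have -> : L * (v - u) = L * (v - b) + L * (b - u) by ring.
by apply: lerD; [apply: gbc => //; exact: ltW | apply: gab => //; exact: ltW].
Qed.

Definition phase {R : realType} (T t : R) : R :=
  t - T * (Num.floor (t / T))%:~R.

Section Phase.
Context {R : realType} (T : R) (T_gt0 : 0 < T).
Implicit Types t : R.

Lemma phase_bounds t : 0 <= phase T t < T.
Proof.
have := floor_itv (t / T); rewrite intrD ler_pdivlMr // ltr_pdivrMr //.
by rewrite /phase; nra.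
Qed.

Lemma phase_id t : 0 <= t < T -> phase T t = t.
Proof.
move=> /andP[t0 tT]; rewrite /phase (@floor_def _ _ 0) ?mulr0 ?subr0 //.
by rewrite add0r divr_ge0 ?(ltW T_gt0)//= ltr_pdivrMr // mul1r.
Qed.

Lemma phaseD t : phase T (t + T) = phase T t.
Proof.
rewrite /phase mulrDl divff ?gt_eqF // floorDrz ?rpred1 // floor1 intrD; ring.
Qed.

(** Away from the multiples of the period the phase runs at unit speed, so a
periodic extension is locally a translate of the curve that it extends. *)
Lemma phase_near t : phase T t != 0 ->
  \forall s \near t, phase T s = phase T t + (s - t).
Proof.
move=> ph0; have /andP[ph_ge0 ph_lt] := phase_bounds t.
have ph_gt0 : 0 < phase T t by rewrite lt_neqAle eq_sym ph0.
rewrite /phase in ph_gt0 ph_lt *; set n := Num.floor _ in ph_gt0 ph_lt *.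
have near_s : \forall s \near t, T * n%:~R < s /\ s < T * n%:~R + T.
  by apply: filterI; [apply: lt_nbhsr; lra | apply: lt_nbhsl; lra].
apply: filterS near_s => s [ns sn].
rewrite (@floor_def _ (s / T) n); first ring.
by rewrite intrD ler_pdivlMr // ltr_pdivrMr //; apply/andP; split; lra.
Qed.

Lemma phase_eq t : exists n : int, t = phase T t + T * n%:~R.
Proof. by exists (Num.floor (t / T)); rewrite /phase; ring. Qed.

(** Two times in different periods are compared through the ends of their own
periods, where the curve takes the common value [g 0]; the whole periods lying
in between only increase the elapsed time. *)
Lemma lipschitz_between_periodic (V : normedModType R) (L : R) (g : R -> V) :
    (forall t, g t = g (phase T t)) -> g T = g 0 ->
    lipschitz_between L 0 T g ->
  forall a b, lipschitz_between L a b g.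
Proof.
move=> gper gT gL a b u v _ uv _; rewrite (gper u) (gper v).
have /andP[u0 uT] := phase_bounds u; have /andP[v0 vT] := phase_bounds v.
have [n Eu] := phase_eq u; have [m Ev] := phase_eq v.
have L0 : 0 <= L.
  (* The inequality over the full period forces the constant to be >= 0. *)
  have /(le_trans (normr_ge0 _)) := gL 0 T (lexx _) (ltW T_gt0) (lexx _).
  by rewrite subr0 pmulr_lge0.
have [mn|nm|mn] := ltgtP m n.
- have : (m + 1)%:~R <= n%:~R :> R by rewrite ler_int lezD1.
  by rewrite intrD => mnR; exfalso; clear -T_gt0 uv Eu Ev u0 uT v0 vT mnR; nra.
- have mnR : n%:~R + 1 <= m%:~R :> R by rewrite -(intrD _ n 1) ler_int lezD1.
  apply: le_trans (ler_distD (g 0) _ _) _.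
  have gv := gL 0 _ (lexx _) v0 (ltW vT).
  have gu := gL _ T u0 (ltW uT) (lexx _).
  rewrite -gT; rewrite -gT in gv.
  have uvle : phase T v - 0 + (T - phase T u) <= v - u.
    by clear -T_gt0 uv Eu Ev u0 uT v0 vT mnR; nra.
  by apply: le_trans (lerD gv gu) _; rewrite -mulrDr; exact: ler_wpM2l.
- have -> : v - u = phase T v - phase T u by rewrite {1}Ev {1}Eu mn; ring.
  by apply: gL => //; [clear -uv Ev Eu mn; rewrite mn in Ev; lra | exact: ltW].
Qed.

End Phase.

(** * Derivatives and null sets *)

Lemma is_derive_pair (R : realType) (U V W : normedModType R)
    (f : U -> V) (g : U -> W) x v df dg :
  is_derive x v f df -> is_derive x v g dg ->
  is_derive x v (fun t => (f t, g t)) (df, dg).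
Proof.
move=> [fx dfx] [gx dgx].
have quotient_cvg : h^-1 *: ((f (h *: v + x), g (h *: v + x)) - (f x, g x))
    @[h --> 0^'] --> (df, dg).
  by rewrite -dfx -dgx; exact: (cvg_pair fx gx).
by apply: DeriveDef; [apply/cvg_ex; exists (df, dg) | exact: cvg_lim].
Qed.

Lemma is_derive_translate (R : realType) (V W : normedModType R)
    (f : V -> W) (c x v : V) df :
  is_derive (x + c) v f df -> is_derive x v (fun t => f (t + c)) df.
Proof.
have quotientE : (fun h : R =>
      h^-1 *: (((fun t => f (t + c)) \o shift x) (h *: v) - f (x + c)))
    = (fun h : R => h^-1 *: ((f \o shift (x + c)) (h *: v) - f (x + c))).
  by apply/funext => h /=; rewrite addrA.
by move=> [fd <-]; apply: DeriveDef; rewrite /derivable /derive quotientE.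
Qed.

Lemma ae_off_countable (R : realType) (N : set R) (P : R -> Prop) :
  countable N -> (forall t, ~ N t -> P t) ->
  {ae @lebesgue_measure R, forall t, P t}.
Proof.
move=> cN NP; have N0 : (@lebesgue_measure R).-negligible N.
  apply/negligibleP; last exact: countable_lebesgue_measure0.
  by apply: countable_measurable => // t; exact: measurable_set1.
by apply: negligibleS N0 => t /= nPt; apply: contrapT => /NP.
Qed.

(** * Alternating two arcs *)

Definition loop {R : realType} (T1 T2 : R) (phi1 phi2 : R -> R * R) (t : R) :
    R * R :=
  let r := phase (T1 + T2) t in if r <= T1 then phi1 r else phi2 (r - T1).

Section Loop.
Context {R : realType} (eps T1 T2 : R) (phi1 phi2 : R -> R * R).
Implicit Types t r : R.
Hypotheses (T1_gt0 : 0 < T1) (T2_gt0 : 0 < T2).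
Hypotheses (phi12 : phi1 T1 = phi2 0) (phi21 : phi2 T2 = phi1 0).

Let T := T1 + T2.
Let gamma := loop T1 T2 phi1 phi2.
Let T_gt0 : 0 < T. Proof. exact: addr_gt0. Qed.

Lemma loop_first t : 0 <= t <= T1 -> gamma t = phi1 t.
Proof.
move=> /andP[t0 tT1]; have T2_pos := T2_gt0.
by rewrite /gamma /loop phase_id ?tT1 //; lra.
Qed.

(** At the closing time [T] the phase is back to 0 and the value is that of the
first arc; it agrees with the end of the second arc because the loop closes. *)
Lemma loop_second t : T1 <= t <= T -> gamma t = phi2 (t - T1).
Proof.
rewrite /T => /andP[T1t]; rewrite le_eqVlt => /orP[/eqP ->|tT].
  have -> : gamma (T1 + T2) = gamma 0.
    by rewrite /gamma /loop -(phaseD T_gt0 0) add0r.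
  by rewrite loop_first ?lexx ?ltW // -phi21; congr phi2; ring.
rewrite /gamma /loop (phase_id T_gt0) ?tT ?andbT; last first.
  by apply: le_trans T1t; exact: ltW.
case: ifP => // tT1; have -> : t = T1 by apply/eqP; rewrite eq_le tT1.
by rewrite subrr.
Qed.

Lemma loop_lipschitz (L : R) :
    lipschitz_between L 0 T1 phi1 -> lipschitz_between L 0 T2 phi2 ->
  forall a b, lipschitz_between L a b gamma.
Proof.
move=> L1 L2; apply: (lipschitz_between_periodic T_gt0).
- move=> t; rewrite /gamma /loop [phase _ (phase _ _)](phase_id T_gt0) //.
  exact: phase_bounds.
- by rewrite loop_second ?loop_first ?lexx ?lerDl ?ltW // -phi21 addrC addKr.
- apply: (@lipschitz_between_glue _ _ _ _ T1) => u v au uv vb.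
    by rewrite !loop_first ?au ?vb ?(le_trans au uv) ?(le_trans uv vb) ?L1.
  rewrite !loop_second ?au ?vb ?(le_trans au uv) ?(le_trans uv vb) //.
  have -> : v - u = (v - T1) - (u - T1) by ring.
  by apply: L2; rewrite ?lerD2r ?subr_ge0 // lerBlDl.
Qed.

(** Off the switching times the curve is locally a translate of one of the two
arcs. It is off the line y = 0 there, where the Filippov set is the single
vector of the system that the arc solves. *)
Lemma loop_derive t :
    phase T t != 0 -> phase T t != T1 ->
    (forall r, is_derive r 1 phi1 (field eps (phi1 r) 0)) ->
    (forall r, is_derive r 1 phi2 (field eps (phi2 r) 1)) ->
    (forall r, 0 < r < T1 -> (phi1 r).2 < 0) ->
    (forall r, 0 < r < T2 -> 0 < (phi2 r).2) ->
  exists2 w, filippov eps (gamma t) w & is_derive t (1 : R) gamma w.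
Proof.
move=> r0 rT1 d1 d2 neg1 pos2; have near_phase := phase_near T_gt0 r0.
have /andP[r_ge0 r_lt] := phase_bounds T_gt0 t.
set r := phase T t in r0 rT1 near_phase r_ge0 r_lt.
have r_gt0 : 0 < r by rewrite lt_neqAle eq_sym r0.
have [rlt|rgt|/eqP] := ltgtP r T1; last by rewrite (negPf rT1).
- have gt : gamma t = phi1 r by rewrite /gamma /loop -/T -/r ltW.
  have := neg1 r; rewrite r_gt0 rlt => /(_ isT) y_lt0.
  exists (field eps (phi1 r) 0).
    rewrite gt /filippov lt_eqF //= /k ltNge ltW //.
  have : is_derive t 1 (fun s => phi1 (s + (r - t))) (field eps (phi1 r) 0).
    by apply: is_derive_translate; rewrite addrC subrK.
  apply: near_eq_is_derive.
  have sT : \forall s \near t, s < T1 - r + t by apply: lt_nbhsl; lra.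
  apply: filterS2 near_phase sT => s rs sT1.
  by rewrite /gamma /loop -/T rs ifT; [congr phi1; ring | lra].
- have gt : gamma t = phi2 (r - T1) by rewrite /gamma /loop -/T -/r leNgt rgt.
  have := pos2 (r - T1); rewrite subr_gt0 rgt ltrBlDl r_lt => /(_ isT) y_gt0.
  exists (field eps (phi2 (r - T1)) 1).
    by rewrite gt /filippov gt_eqF //= /k y_gt0.
  have : is_derive t 1 (fun s => phi2 (s + (r - T1 - t)))
      (field eps (phi2 (r - T1)) 1).
    by apply: is_derive_translate; rewrite addrC subrK.
  apply: near_eq_is_derive.
  have sT : \forall s \near t, T1 - r + t < s by apply: lt_nbhsr; lra.
  apply: filterS2 near_phase sT => s rs sT1.
  by rewrite /gamma /loop -/T rs ifF; [congr phi2; ring | apply/negbTE; lra].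
Qed.

Lemma loop_periodic_orbit (L1 L2 : R) :
    0 <= L1 -> 0 <= L2 ->
    lipschitz_between L1 0 T1 phi1 -> lipschitz_between L2 0 T2 phi2 ->
    (forall r, is_derive r 1 phi1 (field eps (phi1 r) 0)) ->
    (forall r, is_derive r 1 phi2 (field eps (phi2 r) 1)) ->
    (forall r, 0 < r < T1 -> (phi1 r).2 < 0) ->
    (forall r, 0 < r < T2 -> 0 < (phi2 r).2) ->
  periodic_orbit eps (range gamma).
Proof.
move=> L1_ge0 L2_ge0 lip1 lip2 d1 d2 neg1 pos2; exists gamma; split => //.
- split.
    move=> a b _; apply: (@lipschitz_between_abs_continuous _ _ (L1 + L2)).
      exact: addr_ge0.
    apply: loop_lipschitz => u v u0 uv vb.
      apply: le_trans (lip1 u v u0 uv vb) _.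
      by rewrite ler_wpM2r ?subr_ge0 // lerDl.
    apply: le_trans (lip2 u v u0 uv vb) _.
    by rewrite ler_wpM2r ?subr_ge0 // lerDr.
  (* The switching times are T n and T1 + T n, indexed by a countable type. *)
  pose switch (q : bool * int) : R := (if q.1 then T1 else 0) + T * q.2%:~R.
  apply: (@ae_off_countable _ (range switch)).
    exact: card_le_trans (card_image_le _ _) (countableP _).
  move=> t tN; have [n tE] := phase_eq T t.
  apply: loop_derive => //; apply/eqP => rE; apply: tN.
    by exists (false, n) => //=; rewrite /switch /= -{1}rE.
  by exists (true, n) => //=; rewrite /switch /= -{1}rE.
- by exists T => // t; rewrite /gamma /loop phaseD.
- have T1_pos := T1_gt0; have T2_pos := T2_gt0.
  (* The midpoints of the two arcs lie on opposite sides of the line. *)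
  exists (T1 / 2), (T1 + T2 / 2) => gE.
  have := neg1 (T1 / 2); have := pos2 (T2 / 2).
  have <- : gamma (T1 / 2) = phi1 (T1 / 2) by apply: loop_first; lra.
  have <- : gamma (T1 + T2 / 2) = phi2 (T2 / 2).
    by rewrite loop_second /T; [congr phi2; ring | lra].
  by rewrite gE; lra.
Qed.

End Loop.

(** * Trajectories of the affine systems *)

Definition decay {R : realType} (c t : R) : R := expR (- (c * t)).

Lemma is_derive_decay (R : realType) (c t : R) :
  is_derive t 1 (decay c) (- c * decay c t).
Proof.
rewrite /decay mulrC; apply: (@is_derive1_comp _ expR (fun t => - (c * t))).
by apply: is_derive_eq; rewrite /GRing.scale /= mulr1.
Qed.

(** A time step from [u] to [v] multiplies the exponential by
[decay c (v - u)], which lies between [1 - c * (v - u)] and 1. *)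
Lemma decay_lipschitz (R : realType) (c u v : R) : 0 <= c -> 0 <= u -> u <= v ->
  `|decay c v - decay c u| <= c * (v - u).
Proof.
move=> c0 u0 uv.
have -> : decay c v = decay c u * decay c (v - u).
  by rewrite /decay -expRD; congr expR; ring.
have lo := expR_ge1Dx (- (c * (v - u))).
have d1 : decay c u <= 1 by rewrite -expR0 ler_expR oppr_le0 mulr_ge0.
have d0 : 0 < decay c u by exact: expR_gt0.
have e1 : decay c (v - u) <= 1.
  by rewrite -expR0 ler_expR oppr_le0 mulr_ge0 // subr_ge0.
rewrite -/(decay c (v - u)) in lo.
rewrite distrC ger0_norm; nra.
Qed.

Lemma is_derive_biexp (R : realType) (p q r a b t : R) :
  is_derive t 1 (fun t => p + q * decay a t + r * decay b t)
    (- (a * (q * decay a t)) - b * (r * decay b t)).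
Proof.
have da := is_derive_decay a t; have db := is_derive_decay b t.
by apply: is_derive_eq; rewrite /GRing.scale /=; ring.
Qed.

Lemma biexp_lipschitz (R : realType) (p q r a b u v : R) :
  0 <= a -> 0 <= b -> 0 <= u -> u <= v ->
  `|(p + q * decay a v + r * decay b v) - (p + q * decay a u + r * decay b u)|
    <= (`|q| * a + `|r| * b) * (v - u).
Proof.
move=> a0 b0 u0 uv.
have -> : (p + q * decay a v + r * decay b v)
    - (p + q * decay a u + r * decay b u)
  = q * (decay a v - decay a u) + r * (decay b v - decay b u) by ring.
apply: le_trans (ler_normD _ _) _; rewrite !normrM mulrDl -!mulrA.
by apply: lerD; apply: ler_wpM2l; rewrite ?normr_ge0 ?decay_lipschitz.
Qed.

Definition equilibrium {R : realType} (eps lambda : R) : R * R :=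
  let x := 1 / (1 + lambda) in
  (x, (beta - alpha - (alpha * beta - alpha) * x) / (beta + lambda) - eps).

(** The solution of the system of parameter [lambda] that starts at [(x0, 0)].
The null term of the first component gives both components the same shape, a
constant plus two exponentials, so that the lemmas on such sums cover both. *)
Definition trajectory {R : realType} (eps lambda x0 t : R) : R * R :=
  let e := equilibrium eps lambda in
  let c := x0 - e.1 in
  (e.1 + c * decay (1 + lambda) t + 0 * decay (beta + lambda) t,
   e.2 + - (alpha * c) * decay (1 + lambda) t
     + (alpha * c - e.2) * decay (beta + lambda) t).

Lemma trajectory0 (R : realType) (eps lambda x0 : R) :
  trajectory eps lambda x0 0 = (x0, 0).
Proof. by rewrite /trajectory /decay !mulr0 oppr0 expR0; congr pair; ring. Qed.

Lemma is_derive_trajectory (R : realType) (eps lambda x0 t : R) : 0 <= lambda ->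
  is_derive t 1 (trajectory eps lambda x0)
    (field eps (trajectory eps lambda x0 t) lambda).
Proof.
move=> l0; set e := equilibrium eps lambda; set c := x0 - e.1.
have dx := is_derive_biexp e.1 c 0 (1 + lambda) (beta + lambda) t.
have dy := is_derive_biexp e.2 (- (alpha * c)) (alpha * c - e.2)
  (1 + lambda) (beta + lambda) t.
apply: is_derive_eq (is_derive_pair dx dy) _; rewrite {dx dy} /c /e.
rewrite /field /trajectory /equilibrium /= /alpha /beta.
by congr pair; field; do ?(apply/andP; split); rewrite gt_eqF //; lra.
Qed.

Lemma trajectory_lipschitz (R : realType) (eps lambda x0 : R) : 0 <= lambda ->
  exists2 L, 0 <= L &
    forall b, lipschitz_between L 0 b (trajectory eps lambda x0).
Proof.
move=> l0; have a0 : 0 <= 1 + lambda by lra.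
have b0 : 0 <= beta + lambda by rewrite /beta; lra.
set e := equilibrium eps lambda; set c := x0 - e.1.
pose Lx := `|c| * (1 + lambda) + `|0 : R| * (beta + lambda).
pose Ly :=
  `|- (alpha * c)| * (1 + lambda) + `|alpha * c - e.2| * (beta + lambda).
have Lx0 : 0 <= Lx by rewrite addr_ge0 // mulr_ge0.
have Ly0 : 0 <= Ly by rewrite addr_ge0 // mulr_ge0.
exists (Lx + Ly) => [|b u v u0 uv _]; first exact: addr_ge0.
rewrite /trajectory -/e -/c prod_normE ge_max /=; apply/andP; split.
  apply: le_trans (biexp_lipschitz _ _ _ _ _ u0 uv) _ => //.
  by rewrite ler_wpM2r ?subr_ge0 // lerDl.
apply: le_trans (biexp_lipschitz _ _ _ _ _ u0 uv) _ => //.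
by rewrite ler_wpM2r ?subr_ge0 // lerDr.
Qed.

(** * The crossing equations *)

(** This definition and the next are the trajectories of the two systems in the
variable s = exp (- t / 2), with the root s = 1 of the second component factored
out. *)
Definition lower_arc {R : realType} (eps x0 s : R) : R * R :=
  (1 - (1 - x0) * s ^+ 2,
   (1 - s) * (1 / 5 - eps - 4 / 5 * (1 - x0) * s)).

Definition upper_arc {R : realType} (eps x1 s : R) : R * R :=
  (1 / 2 + (x1 - 1 / 2) * s ^+ 4,
   (1 - s) * (4 / 5 * (x1 - 1 / 2) * s ^+ 3
              - (1 / 15 + eps) * (1 + s + s ^+ 2))).

Lemma decay_half (R : realType) (n : nat) (c t : R) :
  c = n%:R / 2 -> decay c t = decay (1 / 2) t ^+ n.
Proof. by move=> ->; rewrite /decay -expRM_natl; congr expR; field. Qed.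

Lemma trajectory_lowerE (R : realType) (eps x0 t : R) :
  trajectory eps 0 x0 t = lower_arc eps x0 (decay (1 / 2) t).
Proof.
rewrite /trajectory /lower_arc /equilibrium /= /alpha /beta.
rewrite (@decay_half _ 2 (1 + 0)); last by field.
rewrite (@decay_half _ 1 (1 / 2 + 0)); last by field.
by congr pair; field; rewrite ?addr0 ?oner_eq0.
Qed.

Lemma trajectory_upperE (R : realType) (eps x1 t : R) :
  trajectory eps 1 x1 t = upper_arc eps x1 (decay (1 / 2) t).
Proof.
rewrite /trajectory /upper_arc /equilibrium /= /alpha /beta.
rewrite (@decay_half _ 4 (1 + 1)); last by field.
rewrite (@decay_half _ 3 (1 / 2 + 1)); last by field.
by congr pair; field.
Qed.

(** The time at which exp (- t / 2) has decreased to [s]. *)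
Definition passage {R : realType} (s : R) : R := - 2 * ln s.

Lemma passage_gt0 (R : realType) (s : R) : 0 < s < 1 -> 0 < passage s.
Proof. by move=> s01; rewrite /passage nmulr_rgt0 ?ln_lt0 //; lra. Qed.

Lemma decay_passage (R : realType) (s : R) :
  0 < s -> decay (1 / 2) (passage s) = s.
Proof.
move=> s0; rewrite /decay /passage -[RHS](lnK (x := s)) ?posrE //.
by congr expR; field.
Qed.

Lemma decay_before_passage (R : realType) (s t : R) : 0 < s ->
  0 < t < passage s -> s < decay (1 / 2) t < 1.
Proof.
move=> s0 /andP[t0 ts]; apply/andP; split.
  by rewrite -{1}(decay_passage s0) ltr_expR ltrN2 ltr_pM2l.
by rewrite -[ltRHS]expR0 ltr_expR; lra.
Qed.

(** This is (1 - x0) (1 - x1) = (1/3 - 5/4 a)^2, with both crossings expressed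
by the upper arc, multiplied by w^3 to clear the denominators of x1. At w = 1
the difference of the two sides is (1/6 - 5/2 a) (5/6 - 5 a) > 0. *)
Lemma closing_equation (R : realType) (a : R) : 0 < a < 1 / 15 ->
  exists2 w : R, 0 < w < 1 &
    (w ^+ 3 / 2 - 5 / 4 * a * (1 + w + w ^+ 2))
      * (1 / 2 - 5 / 4 * a * (w + w ^+ 2 + w ^+ 3))
    = w ^+ 3 * (1 / 3 - 5 / 4 * a) ^+ 2.
Proof.
move=> a01.
pose p : {poly R} :=
  ('X^3 * (1 / 2)%:P - (5 / 4 * a)%:P * (1%:P + 'X + 'X^2))
    * ((1 / 2)%:P - (5 / 4 * a)%:P * ('X + 'X^2 + 'X^3))
  - 'X^3 * ((1 / 3 - 5 / 4 * a) ^+ 2)%:P.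
have pE w : p.[w] = (w ^+ 3 / 2 - 5 / 4 * a * (1 + w + w ^+ 2))
      * (1 / 2 - 5 / 4 * a * (w + w ^+ 2 + w ^+ 3))
    - w ^+ 3 * (1 / 3 - 5 / 4 * a) ^+ 2.
  by rewrite /p !(hornerD, hornerN, hornerM, hornerXn, hornerX, hornerC); field.
have p1 : 0 < p.[1].
  have -> : p.[1] = (1 / 6 - 5 / 2 * a) * (5 / 6 - 5 * a) by rewrite pE; field.
  by rewrite mulr_gt0 //; lra.
(* This choice makes w0^3 / 2 cancel the term 5/4 a w0^2 of the first factor,
   which becomes negative; it is w0^3 (1 - x1), so x1 exceeds 1 there. *)
pose w0 := 5 / 2 * a.
have w0_gt0 : 0 < w0 by rewrite /w0; lra.
have w0_lt1 : w0 < 1 by rewrite /w0; lra.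
have p0 : p.[w0] <= 0.
  have w2 : w0 ^+ 2 < 1 by rewrite expr_lt1 // ltW.
  have w3 : w0 ^+ 3 < 1 by rewrite expr_lt1 // ltW.
  have w3_ge0 : 0 <= w0 ^+ 3 by rewrite exprn_ge0 // ltW.
  have first_factor :
      w0 ^+ 3 / 2 - 5 / 4 * a * (1 + w0 + w0 ^+ 2) = - (5 / 4 * a * (1 + w0)).
    by rewrite /w0; field.
  rewrite pE first_factor mulNr -opprD oppr_le0 addr_ge0 //.
    by rewrite mulr_ge0 //; nra.
  by rewrite mulr_ge0 // sqr_ge0.
have [|w /andP[w0w w1] /rootP pw] := @poly_ivt _ p w0 1 (ltW w0_lt1).
  by rewrite p0 ltW.
exists w; last by apply/eqP; rewrite -subr_eq0 -pE pw.
rewrite (lt_le_trans w0_gt0 w0w) /= lt_neqAle w1 andbT.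
by apply: contraTneq p1 => <-; rewrite pw ltxx.
Qed.

(** The crossings [x0] (downwards) and [x1] (upwards) of the periodic orbit, and
the values [s], [w] of exp (- t / 2) at the ends of the lower and upper arcs.
Given [w], the upper arc determines [x0] and [x1], and [s] is the zero of the
second factor of the lower arc; the closing equation says that this lower arc
lands at [x1]. *)
Lemma closed_crossings (R : realType) (eps : R) : - (1 / 15) < eps -> eps < 0 ->
  exists x0 x1 s w : R,
    [/\ 1 / 2 < x0 < 3 / 4 + 15 / 4 * eps,
        0 < s < 1 /\ 0 < w < 1,
        lower_arc eps x0 s = (x1, 0) /\ upper_arc eps x1 w = (x0, 0),
        forall r, s < r < 1 -> (lower_arc eps x0 r).2 < 0
      & forall r, w < r < 1 -> 0 < (upper_arc eps x1 r).2].
Proof.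
move=> eps_gt eps_lt; pose a := 1 / 15 + eps.
have a01 : 0 < a < 1 / 15 by rewrite /a; lra.
have epsE : eps = a - 1 / 15 by rewrite /a; ring.
have [w w01 closing] := closing_equation a01; have /andP[w0 w1] := w01.
have w2 : 0 < w ^+ 2 < 1 by rewrite exprn_gt0 ?expr_lt1 // ltW.
have w3 : 0 < w ^+ 3 < 1 by rewrite exprn_gt0 ?expr_lt1 // ltW.
(* d is 1 - x0. *)
pose d := 1 / 2 - 5 / 4 * a * (w + w ^+ 2 + w ^+ 3).
have d_gt : 1 / 3 - 5 / 4 * a < d by rewrite /d; nra.
have d0 : 0 < d by lra.
pose s := (1 / 3 - 5 / 4 * a) / d.
have num_gt0 : 0 < 1 / 3 - 5 / 4 * a by lra.
have s0 : 0 < s by exact: divr_gt0.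
have s1 : s < 1 by rewrite ltr_pdivrMr // [ltRHS]mul1r.
have sd : s * d = 1 / 3 - 5 / 4 * a by rewrite divfK // gt_eqF.
(* b is 4/5 (x1 - 1/2), chosen to put a root of the upper arc at w. *)
pose b := a * (1 + w + w ^+ 2) / w ^+ 3.
have bw : b * w ^+ 3 = a * (1 + w + w ^+ 2).
  by rewrite divfK // gt_eqF //; lra.
(* The lower arc ends at the abscissa x1. *)
have landing : 1 - d * s ^+ 2 = 1 / 2 + 5 / 4 * b.
  have wd0 : w ^+ 3 * d != 0 by rewrite gt_eqF // mulr_gt0 //; lra.
  apply: (mulfI wd0).
  rewrite -/d in closing.
  transitivity (w ^+ 3 * d - w ^+ 3 * (s * d) ^+ 2); first by ring.
  rewrite sd -closing.
  transitivity (w ^+ 3 * d / 2 + 5 / 4 * (b * w ^+ 3) * d); last by field.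
  by rewrite bw; field.
exists (1 - d), (1 / 2 + 5 / 4 * b), s, w; split.
- by rewrite /d epsE; apply/andP; split; nra.
- by rewrite s0 s1 w01.
- split; congr pair.
  + by rewrite -landing; ring.
  + have -> : 4 / 5 * (1 - (1 - d)) * s = 4 / 5 * (s * d) by ring.
    by rewrite sd epsE; field.
  + have -> : 1 / 2 + 5 / 4 * b - 1 / 2 = 5 / 4 * b by ring.
    have -> : 5 / 4 * b * w ^+ 4 = 5 / 4 * (b * w ^+ 3) * w by ring.
    by rewrite bw /d; field.
  + have -> : 4 / 5 * (1 / 2 + 5 / 4 * b - 1 / 2) * w ^+ 3 = b * w ^+ 3.
      by field.
    by rewrite bw epsE; field.
- move=> r /andP[sr r1] /=; rewrite pmulr_rlt0 ?subr_gt0 //.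
  have : s * d < r * d by rewrite ltr_pM2r.
  by rewrite sd epsE; lra.
- move=> r /andP[wr r1] /=; rewrite pmulr_rgt0 ?subr_gt0 //.
  have r0 : 0 < r by lra.
  rewrite -subr_gt0 -(pmulr_rgt0 _ (exprn_gt0 3 w0)).
  have -> : w ^+ 3 * (4 / 5 * (1 / 2 + 5 / 4 * b - 1 / 2) * r ^+ 3
      - (1 / 15 + eps) * (1 + r + r ^+ 2))
    = b * w ^+ 3 * r ^+ 3 - a * w ^+ 3 * (1 + r + r ^+ 2) by rewrite /a; field.
  (* w is a root in r, and the cofactor of r - w has positive terms only. *)
  rewrite bw.
  have -> : a * (1 + w + w ^+ 2) * r ^+ 3 - a * w ^+ 3 * (1 + r + r ^+ 2)
    = a * (r - w) * (r ^+ 2 + r * w + w ^+ 2 + w * r * (r + w)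
                     + w ^+ 2 * r ^+ 2) by ring.
  rewrite mulr_gt0 //; first by rewrite mulr_gt0 ?subr_gt0 //; lra.
  by rewrite !addr_gt0 ?mulr_gt0 ?exprn_gt0 ?addr_gt0.
Qed.

Theorem theorem3 (R : realType) (eps : R) (heps : - (1 / 15) < eps)
    (heps0 : eps < 0) :
  exists Gamma : set (R * R),
    periodic_orbit eps Gamma /\
    exists x : R, x \in `](1 / 2), (3 / 4 + 15 / 4 * eps)[%R /\ Gamma (x, 0).
Proof.
have [x0 [x1 [s [w [x0I [s01 w01] [lands returns] below above]]]]] :=
  closed_crossings heps heps0.
have /andP[s0 _] := s01; have /andP[w0 _] := w01.
have T1_gt0 := passage_gt0 s01; have T2_gt0 := passage_gt0 w01.
have glue01 : trajectory eps 0 x0 (passage s) = trajectory eps 1 x1 0.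
  by rewrite trajectory_lowerE decay_passage // lands trajectory0.
have glue10 : trajectory eps 1 x1 (passage w) = trajectory eps 0 x0 0.
  by rewrite trajectory_upperE decay_passage // returns trajectory0.
have [L1 L1_ge0 lip1] := trajectory_lipschitz eps x0 (lexx (0 : R)).
have [L2 L2_ge0 lip2] := trajectory_lipschitz eps x1 (@ler01 R).
exists (range (loop (passage s) (passage w)
  (trajectory eps 0 x0) (trajectory eps 1 x1))).
split.
  apply: (loop_periodic_orbit T1_gt0 T2_gt0 glue01 glue10 L1_ge0 L2_ge0
    (lip1 _) (lip2 _)) => t.
  - exact: is_derive_trajectory.
  - exact: is_derive_trajectory.
  - by move/(decay_before_passage s0)/below; rewrite -trajectory_lowerE.
  - by move/(decay_before_passage w0)/above; rewrite -trajectory_upperE.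
exists x0; split; first by rewrite in_itv.
by exists 0 => //; rewrite loop_first ?trajectory0 // lexx ltW.
Qed.
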